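(* Let $m\ge2$ and $\omega>0$ be fixed, and let $v_1,v_2,\ldots,v_m\in L_1[0,\omega]$ be real-valued. Suppose there exists $R>0$ such that for every $r$ with $0<r<R$ the system of equations $$v_i(t)=u_i(t)-\frac{r\,u_{i+1}(t)}{1-rE_{x_1}[u](t)},\quad i=1,\ldots,m-1,\qquad v_m(t)=u_m(t),$$ has a solution $u_1,u_2,\ldots,u_m\in L_1[0,\omega]$ with $E_{x_1}[u](t):=\int_0^t u_1(\tau)\,d\tau<1/r$ on the interval $[0,\omega]$ and $E_{x_1}[u](\omega)=0$. Then the Abel equation of degree $m+1$, $$\dot z(t)=\sum_{i=1}^m v_i(t)z^{i+1}(t),$$ has a center at $z=0$.
   Context: The Abel equation has a center at $z=0$ (for the fixed $\omega>0$) if, for all sufficiently small $r>0$, its solution with $z(0)=r$ is defined on $[0,\omega]$ and satisfies $z(\omega)=z(0)=r$. Since the coefficients are in $L_1$, solutions are understood as absolutely continuous functions satisfying the equation almost everywhere, and equalities between $L_1$ functions hold almost everywhere. *)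

(* Defs.v *)
(* MathComp-Analysis, over an arbitrary [R : realType]. *)
From mathcomp Require Import all_boot all_order all_algebra.
From mathcomp Require Import all_classical all_reals all_analysis.
Import Order.TTheory GRing.Theory Num.Theory.
Import numFieldNormedType.Exports.

Set Implicit Arguments.
Unset Strict Implicit.
Unset Printing Implicit Defensive.

Local Open Scope classical_set_scope.
Local Open Scope ring_scope.

(* Families such as [v] and [u] are indexed by nat; only the indices
   1, ..., m are ever used. *)

Definition L1 (R : realType) (omega : R) (f : R -> R) : Prop :=
  (@lebesgue_measure R).-integrable `[0, omega] (EFin \o f).

Definition ae_on (R : realType) (omega : R) (P : R -> Prop) : Prop :=
  {ae @lebesgue_measure R, forall t, t \in `[0, omega]%R -> P t}.

Definition E_x1 (R : realType) (u : nat -> R -> R) (t : R) : R :=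
  \int[@lebesgue_measure R]_(tau in `[0, t]) u 1%N tau.

Definition absolutely_continuous (R : realType) (a b : R) (f : R -> R) : Prop :=
  forall eps : R, 0 < eps -> exists2 delta : R, 0 < delta &
    forall (n : nat) (x y : 'I_n -> R),
      (forall k, a <= x k /\ x k <= y k /\ y k <= b) ->
      trivIset [set: 'I_n] (fun k => `]x k, y k[%classic) ->
      \sum_(k < n) (y k - x k) < delta ->
      \sum_(k < n) `|f (y k) - f (x k)| < eps.

(* Solution on the whole of [0, omega] of
   z' = v_1 z^2 + ... + v_m z^(m+1), z(0) = r.
   The values of [z] outside [0, omega] do not matter: they can only affect the
   two-sided derivative at the endpoints, which form a null set. *)
Definition abel_solution (R : realType) (m : nat) (omega : R)
    (v : nat -> R -> R) (r : R) (z : R -> R) : Prop :=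
  [/\ absolutely_continuous 0 omega z,
      ae_on omega (fun t =>
        is_derive t 1 z (\sum_(1 <= i < m.+1) v i t * z t ^+ i.+1))
    & z 0 = r].

(* The two conjuncts render "its solution with z(0) = r is defined on
   [0, omega] and satisfies z(omega) = r" without presupposing that the
   solution is unique. *)
Definition abel_center (R : realType) (m : nat) (omega : R)
    (v : nat -> R -> R) : Prop :=
  exists2 r0 : R, 0 < r0 &
    forall r : R, 0 < r -> r < r0 ->
      (exists z : R -> R, abel_solution m omega v r z) /\
      (forall z : R -> R, abel_solution m omega v r z -> z omega = r).

(* Main.v *)
(* With E = E_x1 u, the function z = r / (1 - r E) satisfies z' = u_1 z^2, and
   since the system reads v_i = u_i - z u_(i+1), the right-hand side of the
   Abel equation telescopes to u_1 z^2; moreover z(omega) = r as E(omega) = 0.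
   Any other solution agrees with this one: the difference w of two solutions
   satisfies |w'| <= L |w| with L integrable, so w^2 exp(-2 int L) has a
   nonpositive derivative almost everywhere, and an absolutely continuous
   function with this property is nonincreasing. *)
Require Import Defs.
From mathcomp Require Import all_boot all_order all_algebra.
From mathcomp Require Import all_classical all_reals all_analysis.
From mathcomp Require Import measurable_realfun ring lra.
Import Order.TTheory GRing.Theory Num.Theory.
Import numFieldNormedType.Exports.
Set Implicit Arguments.
Unset Strict Implicit.
Unset Printing Implicit Defensive.
Local Open Scope classical_set_scope.
Local Open Scope ring_scope.

(** * Absolutely continuous functions *)

(** Common source of the closure properties used below: products, differences, exponentials and
    quotients each reduce to an increment estimate. *)
Lemma ac_dominated (R : realType) (a b K : R) (f g h : R -> R) :
  0 <= K -> absolutely_continuous a b g -> absolutely_continuous a b h ->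
  (forall x y, a <= x -> x <= y -> y <= b ->
    `|f y - f x| <= K * (`|g y - g x| + `|h y - h x|)) ->
  absolutely_continuous a b f.
Proof.
move=> K0 acg ach fgh e e0.
(* The factor 2 splits [e] between [g] and [h]; [K + 1] keeps the denominator positive when
   [K = 0]. *)
have e'0 : 0 < e / (2 * (K + 1)) by rewrite divr_gt0// mulr_gt0//; lra.
have [d1 d10 hd1] := acg _ e'0; have [d2 d20 hd2] := ach _ e'0.
exists (Num.min d1 d2); first by rewrite lt_min d10.
move=> n x y xy tI; rewrite lt_min => /andP[sd1 sd2].
have := hd1 n x y xy tI sd1; have := hd2 n x y xy tI sd2.
set sh := \sum_(k < n) _; set sg := \sum_(k < n) _ => shlt sglt.
have sfle : \sum_(k < n) `|f (y k) - f (x k)| <= K * (sg + sh).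
  rewrite -big_split/= mulr_sumr; apply: ler_sum => k _.
  by have [? [? ?]] := xy k; exact: fgh.
apply: (le_lt_trans sfle).
have s0 : 0 <= sg + sh by rewrite addr_ge0// sumr_ge0.
have : sg + sh < e / (K + 1).
  have -> : e / (K + 1) = e / (2 * (K + 1)) + e / (2 * (K + 1)).
    by field; rewrite gt_eqF//; lra.
  exact: ltrD.
rewrite ltr_pdivlMr; last lra.
by apply: le_lt_trans; nra.
Qed.

Lemma ac_pointwise (R : realType) (a b : R) (f : R -> R) :
  absolutely_continuous a b f -> forall e, 0 < e -> exists2 d, 0 < d &
    forall x y, a <= x <= b -> a <= y <= b -> `|x - y| < d ->
      `|f x - f y| < e.
Proof.
move=> acf e e0; have [d d0 hd] := acf e e0; exists d => // x y xab yab.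
wlog xy : x y xab yab / x <= y.
  move=> H; case: (leP x y) => [xy|/ltW yx]; first exact: H.
  by rewrite distrC => xyd; rewrite distrC; exact: H.
move=> xyd.
(* A family made of the single interval from [x] to [y]. *)
have := hd 1%N (fun=> x) (fun=> y); rewrite !big_ord1 distrC; apply.
- by move=> _; case/andP: xab; case/andP: yab.
- by move=> i j _ _ _; rewrite (ord1 i) (ord1 j).
- by rewrite -(ger0_norm (_ : 0 <= y - x)) ?subr_ge0// distrC.
Qed.

Lemma ac_continuous (R : realType) (a b : R) (f : R -> R) :
  absolutely_continuous a b f -> {within `[a, b]%classic, continuous f}.
Proof.
move=> acf; apply/subspace_continuousP => x /=; rewrite in_itv/= => xab.
apply/cvgrPdist_lt => e e0; have [d d0 hd] := ac_pointwise acf e0.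
rewrite near_withinE; near=> y => /=; rewrite in_itv/= => yab.
apply: hd => //; near: y; exact: cvgr_dist_lt.
Unshelve. all: by end_near. Qed.

Lemma ac_bounded (R : realType) (a b : R) (f : R -> R) : a <= b ->
  absolutely_continuous a b f ->
  exists2 M, 0 <= M & forall x, a <= x <= b -> `|f x| <= M.
Proof.
move=> ab acf.
have : absolutely_continuous a b (Num.norm \o f).
  apply: (ac_dominated ler01 acf acf) => x y _ _ _ /=; rewrite mul1r.
  by apply: (le_trans (ler_dist_dist _ _)); rewrite lerDl.
move=> /ac_continuous /(EVT_max ab)[c _ hc].
by exists `|f c| => // x xab; apply: hc; rewrite in_itv.
Qed.

Lemma acM (R : realType) (a b : R) (f g : R -> R) : a <= b ->
  absolutely_continuous a b f -> absolutely_continuous a b g ->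
  absolutely_continuous a b (fun x => f x * g x).
Proof.
move=> ab acf acg.
have [M M0 hM] := ac_bounded ab acf; have [N N0 hN] := ac_bounded ab acg.
apply: (ac_dominated (addr_ge0 M0 N0) acf acg) => x y ax xy yb.
have -> : f y * g y - f x * g x = (f y - f x) * g y + f x * (g y - g x) by ring.
apply: (le_trans (ler_normD _ _)); rewrite !normrM.
have := hM x; have := hN y.
rewrite ax yb (le_trans xy yb) (le_trans ax xy) => /(_ isT) gy /(_ isT) fx.
have := normr_ge0 (f y - f x); have := normr_ge0 (g y - g x); nra.
Qed.

Lemma acB (R : realType) (a b : R) (f g : R -> R) :
  absolutely_continuous a b f -> absolutely_continuous a b g ->
  absolutely_continuous a b (fun x => f x - g x).
Proof.
move=> acf acg; apply: (ac_dominated ler01 acf acg) => x y _ _ _.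
by rewrite mul1r opprD addrACA -opprD ler_normB.
Qed.

(** * Cousin's lemma and monotonicity from the sign of the derivative *)

(** Let [S] be the set of points reachable from [a]. The local property at [sup S] carries some
    point of [S] past [sup S], unless [b] is already within reach. *)
Lemma cousin (R : realType) (P : R -> R -> Prop) (a b : R) : a <= b ->
  (forall x y z, a <= x -> x <= y -> y <= z -> z <= b ->
    P x y -> P y z -> P x z) ->
  (forall t, a <= t <= b -> exists2 d, 0 < d &
    forall x y, a <= x -> x <= t -> t <= y -> y <= b ->
      t - d < x -> y < t + d -> P x y) ->
  P a b.
Proof.
move=> ab Padd Ploc.
pose S := [set x | a <= x <= b /\ P a x]%classic.
have Sa : S a.
  split; first by rewrite lexx.
  have [|d d0] := Ploc a; first by rewrite lexx.
  by apply; lra.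
have supS : has_sup S by split; [exists a|exists b => x [/andP[]]].
have as_ : a <= sup S by apply: ub_le_sup => //; case: supS.
have sb : sup S <= b by apply: ge_sup => [|x [/andP[]]]; first by exists a.
have [|d d0 hd] := Ploc (sup S); first by rewrite as_.
have [x [/andP[ax xb] Pax] dx] := sup_adherent d0 supS.
have xs : x <= sup S by apply: ub_le_sup; [case: supS|split; [rewrite ax|]].
(* Either [P x b] holds by the local property, or [sup S + d / 2] would belong to [S]. *)
have [bd|bd] := ltP b (sup S + d).
  by apply: (Padd a x b) => //; exact: hd.
have : S (sup S + d / 2).
  split; first by lra.
  by apply: (Padd a x) => //; [lra|lra|apply: hd => //; lra].
by move=> /(ub_le_sup (proj2 supS)); lra.
Qed.

(** Translates the total length in the definition of absolute continuity into a measure, so that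
    measure-theoretic smallness can be used. *)
Lemma lebesgue_measure_bigsetU_itv (R : realType) (n : nat) (x y : 'I_n -> R) :
  (forall k, x k <= y k) ->
  trivIset [set: 'I_n] (fun k => `]x k, y k[%classic) ->
  lebesgue_measure (\big[setU/set0]_(k < n) `]x k, y k[%classic) =
    (\sum_(k < n) (y k - x k))%:E.
Proof.
move=> xy tI; rewrite measure_bigsetU_ord//= -sumEFin; apply: eq_bigr => k _.
rewrite lebesgue_measure_itv/= lte_fin; case: ltP => // yx.
by rewrite (le_anti (introT andP (conj yx (xy k)))) subrr.
Qed.

(** Near [t] the difference quotients based at [t] stay below [D + e <= e]. Since [t] lies between
    [x] and [y], the bounds on its two sides add up. *)
Lemma is_derive_le0_increment (R : realType) (F : R -> R) (t D e : R) :
  is_derive t 1 F D -> D <= 0 -> 0 < e -> exists2 d, 0 < d &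
    forall x y, t - d < x -> x <= t -> t <= y -> y < t + d ->
      F y - F x <= e * (y - x).
Proof.
move=> [dF FD] D0 e0.
have : h^-1 *: ((F \o shift t) (h *: 1) - F t) @[h --> 0^'] --> D.
  by rewrite -FD; exact: dF.
move=> /cvgrPdist_lt /(_ e e0) /nbhs_ballP[d /= d0 hd]; exists d => // x y dx xt ty yd.
have slope h : h != 0 -> `|h| < d -> (F (t + h) - F t) / h < e.
  move=> h0 hh; have := hd h; rewrite /ball/= sub0r normrN => /(_ hh h0).
  rewrite /GRing.scale/= mulr1 (addrC h t) [_^-1 * _]mulrC ltr_norml => /andP[+ _].
  by lra.
have yt : F y - F t <= e * (y - t).
  have [->|ty'] := eqVneq y t; first by rewrite !subrr mulr0.
  have := slope (y - t); rewrite subr_eq0 ty' ger0_norm ?subr_ge0// subrKC.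
  move=> /(_ isT) H; have {}H : (F y - F t) / (y - t) < e by apply: H; lra.
  by rewrite ltW// -ltr_pdivrMr// subr_gt0 lt_neqAle eq_sym ty'.
have tx : F t - F x <= e * (t - x).
  have [->|tx'] := eqVneq x t; first by rewrite !subrr mulr0.
  have := slope (x - t); rewrite subr_eq0 tx' ler0_norm ?subr_le0// subrKC.
  move=> /(_ isT) H; have {}H : (F x - F t) / (x - t) < e by apply: H; lra.
  rewrite ltW// -ltr_pdivrMr; last by rewrite subr_gt0 lt_neqAle tx'.
  by rewrite -mulrNN -invrN !opprB.
lra.
Qed.

(* Cover the exceptional null set by an open set too small for [F] to vary on
   it, and apply Cousin's lemma to the intervals on which the increment of [F]
   is at most [e] times the length, up to the variation inside that open set. *)
Lemma ac_derive_le0 (R : realType) (a b : R) (F : R -> R) : a <= b ->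
  absolutely_continuous a b F ->
  {ae @lebesgue_measure R, forall t, t \in `[a, b]%R ->
    exists2 D, is_derive t 1 F D & D <= 0} ->
  F b <= F a.
Proof.
move=> ab acF [N [mN N0 badN]].
suff Fe e : 0 < e -> F b - F a <= e * (b - a) + e.
  rewrite -subr_le0; apply/ler_addgt0Pl => e e0; rewrite addr0.
  (* The choice [e / (b - a + 1)] turns the bound [e * (b - a) + e] into exactly [e]. *)
  have c0 : 0 < b - a + 1 by lra.
  have := Fe (e / (b - a + 1)) (divr_gt0 e0 c0).
  by rewrite -[X in _ <= _ + X]mulr1 -mulrDr divfK ?gt_eqF.
move=> e0; have [delta d0 hdelta] := acF e e0.
have {}N0 : lebesgue_measure N = 0%E := N0.
have Noo : (lebesgue_measure N < +oo)%E by rewrite N0.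
have [U [oU NU Ud]] := lebesgue_regularity_outer mN Noo d0.
have mU : measurable U := open_measurable oU.
have {}Ud : (lebesgue_measure U < delta%:E)%E.
  rewrite -(setDUK NU) measureU ?setDIK//; last exact: measurableD.
  by rewrite [X in (X + _)%E]N0 add0e.
(* [s] lists ordered subintervals contained in [U], which absorb the uncontrolled variation of [F];
   concatenating lists makes [P] additive. *)
pose P x y := exists s : seq (R * R),
  [/\ all (fun p => [&& x <= p.1, p.1 <= p.2 & p.2 <= y]) s,
      pairwise (fun p q : R * R => p.2 <= q.1) s,
      (forall p, p \in s -> `[p.1, p.2] `<=` U) &
      F y - F x <= e * (y - x) + \sum_(p <- s) `|F p.2 - F p.1|].
have : P a b.
  apply: cousin => //.
  - move=> x y z _ xy yz _ [s [sxy ps sU sF]] [s' [syz ps' sU' sF']].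
    exists (s ++ s'); split.
    + rewrite all_cat; apply/andP; split.
        by apply: sub_all sxy => p /and3P[-> -> /le_trans->].
      by apply: sub_all syz => p /and3P[/(le_trans xy)-> -> ->].
    + rewrite pairwise_cat ps ps' !andbT; apply/allrelP => p q.
      move=> /(allP sxy)/and3P[_ _ py] /(allP syz)/and3P[yq _ _].
      exact: le_trans py yq.
    + by move=> p; rewrite mem_cat => /orP[/sU|/sU'].
    + by rewrite big_cat/=; lra.
  (* Around an exceptional point the whole interval goes into the list; around any other point the
     derivative bound allows the empty list. *)
  - move=> t tab; have [Nt|nNt] := pselect (N t).
      have /nbhs_ballP[d d'0 dU] : nbhs t U.
        by rewrite nbhsE; exists U => //; split => //; exact: NU.
      exists d => // x y _ xt ty _ dx yd; have xy := le_trans xt ty.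
      exists [:: (x, y)]; split => //=.
      + by rewrite !lexx xy.
      + move=> p; rewrite inE => /eqP-> z /=; rewrite in_itv/= => /andP[xz zy].
        apply: dU; rewrite /ball/= ltr_distlC.
        by apply/andP; split; lra.
      + rewrite big_seq1 (le_trans (ler_norm _))//= lerDr.
        by apply: mulr_ge0; [exact: ltW|rewrite subr_ge0].
    have [D FD D0] : exists2 D, is_derive t 1 F D & D <= 0.
      apply: contrapT => nD; apply: nNt; apply: badN => /= H; apply: nD.
      by apply: H; rewrite in_itv.
    have [d d'0 hd] := is_derive_le0_increment FD D0 e0.
    exists d => // x y _ xt ty _ dx yd; exists [::]; split => //=.
    by rewrite big_nil addr0; exact: hd.
move=> [s [sab ps sU sF]]; apply: (le_trans sF); rewrite lerD2l ltW//.
pose l (k : 'I_(size s)) := (nth (0, 0) s k).1.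
pose r (k : 'I_(size s)) := (nth (0, 0) s k).2.
have sk (k : 'I_(size s)) : nth (0, 0) s k \in s by exact: mem_nth.
have lr k : l k <= r k by have /and3P[] := allP sab _ (sk k).
have rl (i j : 'I_(size s)) : (i < j)%N -> r i <= l j.
  by move=> ij; apply: (pairwiseP (0, 0) ps); rewrite ?inE.
have tI : trivIset [set: 'I_(size s)] (fun k => `]l k, r k[%classic).
  move=> i j _ _ [z [/=]]; rewrite !in_itv/= => /andP[iz zi] /andP[jz zj].
  have [ij|ji|] := ltngtP i j; last exact: ord_inj.
    by have := lt_trans jz zi; rewrite ltNge rl.
  by have := lt_trans iz zj; rewrite ltNge rl.
rewrite (big_nth (0, 0)) big_mkord; apply: (hdelta _ l r) => //.
  by move=> k; have /and3P[? ? ?] := allP sab _ (sk k).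
(* The disjoint intervals lie in [U], so their total length is at most the measure of [U], which is
   below [delta]. *)
rewrite -lte_fin -lebesgue_measure_bigsetU_itv//; apply: le_lt_trans Ud.
apply: le_measure; rewrite ?inE//; first exact: bigsetU_measurable.
rewrite -bigcup_seq => z [k _ zk]; apply: (sU _ (sk k)).
exact: subset_itv_oo_cc zk.
Qed.

(** * Indefinite integrals of integrable functions *)

Lemma Rintegral_bigsetU_ord d (T : measurableType d) (R : realType)
    (mu : {measure set T -> \bar R}) (n : nat) (F : 'I_n -> set T) (f : T -> R) :
  (forall k, measurable (F k)) -> trivIset [set: 'I_n] F ->
  mu.-integrable [set: T] (EFin \o f) ->
  \int[mu]_(x in \big[setU/set0]_(k < n) F k) f x =
    \sum_(k < n) \int[mu]_(x in F k) f x.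
Proof.
move=> mF tF intf.
have mU : measurable (\big[setU/set0]_(k < n) F k) by exact: bigsetU_measurable.
rewrite /Rintegral integral_bigsetU_EFin//.
- rewrite sum_fine// => k _; apply: integrable_fin_num => //.
  exact: integrableS intf.
- exact: index_enum_uniq.
- exact: sub_trivIset tF.
- by apply: (@measurable_funS _ _ _ _ setT) => //; exact: measurable_int intf.
Qed.

(** The integral of [|f|] over sets of small measure is uniformly small; this is applied to the
    union of the given intervals. *)
Lemma ac_Rintegral (R : realType) (a b : R) (f : R -> R) :
  (@lebesgue_measure R).-integrable `[a, b] (EFin \o f) ->
  absolutely_continuous a b (fun x => \int[@lebesgue_measure R]_(t in `[a, x]) f t).
Proof.
(* [g] extends [f] by zero, hence is integrable on the whole line. *)
move=> intf e e0; set mu := @lebesgue_measure R; pose g := f \_ `[a, b].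
have intg : mu.-integrable setT (EFin \o g).
  by rewrite /g -restrict_EFin; apply/integrable_restrict => //=; rewrite setTI.
have [d [d0 hd]] := integral_normr_continuous intg e0.
exists d => // n x y xy tI sd.
have mI (k : 'I_n) : measurable (`]x k, y k[%classic : set R) by exact: measurable_itv.
apply: le_lt_trans (hd (\big[setU/set0]_(k < n) `]x k, y k[%classic) _ _); last 2 first.
- exact: bigsetU_measurable.
- rewrite [X in (X < _)%E](lebesgue_measure_bigsetU_itv _ tI) ?lte_fin// => k.
  by have [_ []] := xy k.
rewrite Rintegral_bigsetU_ord//; last exact: integrable_norm intg.
apply: ler_sum => k _; have [ax [xyk yb]] := xy k.
have sub (i : interval R) : [set` i] `<=` `[a, b] ->
    mu.-integrable [set` i] (EFin \o f).
  by move=> ib; apply: integrableS intf.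
rewrite Rintegral_itvB ?bnd_simp//; last first.
  by apply: sub; exact: subset_itvl.
have xyab : `]x k, y k] `<=` `[a, b].
  by move=> t /=; rewrite !in_itv/= => /andP[xt ty]; apply/andP; split; lra.
apply: le_trans (le_normr_Rintegral _ (sub _ xyab)) _ => //.
rewrite -Rintegral_itv_bndo_bndc; last first.
  apply: integrable_norm; apply: sub; apply: subset_trans xyab.
  exact: subset_itv_oo_oc.
rewrite le_eqVlt; apply/orP; left; apply/eqP; apply: eq_Rintegral => t.
rewrite inE/= => txy; rewrite /g patchE mem_set//; apply: xyab.
exact: subset_itv_oo_oc txy.
Qed.

(** Lebesgue differentiation for the extension of [f] by zero. The endpoints are discarded as a null
    set, so that [t] is interior and both integrands agree up to points near [t]. *)
Lemma ae_is_derive_Rintegral (R : realType) (a b : R) (f : R -> R) :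
  (@lebesgue_measure R).-integrable `[a, b] (EFin \o f) ->
  {ae @lebesgue_measure R, forall t, t \in `[a, b]%R ->
    is_derive t 1 (fun x => \int[@lebesgue_measure R]_(s in `[a, x]) f s) (f t)}.
Proof.
move=> intf; set mu := @lebesgue_measure R; pose g := f \_ `[a, b].
have intg : mu.-integrable setT (EFin \o g).
  by rewrite /g -restrict_EFin; apply/integrable_restrict => //=; rewrite setTI.
have ae_neq (c : R) : {ae mu, forall t, t != c}.
  exists [set c]; split => //; first exact: lebesgue_measure_set1.
  by move=> t /= /negP; rewrite negbK => /eqP.
have intgS (y : R) : mu.-integrable [set` `[a, y]] (EFin \o g).
  by apply: integrableS intg.
have locg : locally_integrable [set: R] g.
  exact: integrable_locally.
apply: filterS3 (FTC1 intgS locg) (ae_neq a) (ae_neq b).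
  exact: (ae_filter_ringOfSetsType mu).
move=> t + ta tb; rewrite in_itv/= => FTC /andP[at_ tb'].
have {}at_ : a < t by rewrite lt_neqAle eq_sym ta.
have {}tb' : t < b by rewrite lt_neqAle tb.
have [|dg gE] := FTC; first by rewrite lte_fin.
have <- : g t = f t by rewrite /g patchE mem_set//= in_itv/= !ltW.
apply: (@near_eq_is_derive _ _ _ (fun x => \int[mu]_(s in `[a, x]) g s)).
  near=> x; apply: eq_Rintegral => s; rewrite inE/= in_itv/= => /andP[as_ sx].
  rewrite /g patchE mem_set//= in_itv/= as_ (le_trans sx)//.
  by near: x; exact: lt_le_nbhsl.
by rewrite -gE derive1E; exact/derivableP.
Unshelve. all: by end_near. Qed.

(** * Gronwall's argument and uniqueness *)

(** For [x <= y <= 0], factor out [expR y <= 1] and use [1 + s <= expR s] at [s = x - y]. *)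
Lemma expR_le0_lipschitz (R : realType) (x y : R) : x <= 0 -> y <= 0 ->
  `|expR x - expR y| <= `|x - y|.
Proof.
wlog xy : x y / x <= y.
  move=> H x0 y0; have [xy|/ltW yx] := leP x y; first exact: H.
  by rewrite distrC [leRHS]distrC; exact: H.
move=> x0 y0; rewrite distrC ger0_norm; last by rewrite subr_ge0 ler_expR.
rewrite distrC ger0_norm ?subr_ge0//.
have -> : expR x = expR y * expR (x - y) by rewrite -expRD subrKC.
have := expR_ge1Dx (x - y); have := expR_gt0 y.
have : expR y <= 1 by rewrite -expR0 ler_expR.
have : expR (x - y) <= 1 by rewrite -expR0 ler_expR subr_le0.
nra.
Qed.

(* By Gronwall's argument, [w ^ 2 * exp (- 2 * int L)] is nonincreasing. *)
Lemma ac_gronwall_eq0 (R : realType) (a b : R) (w L : R -> R) : a <= b ->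
  (forall t, 0 <= L t) ->
  (@lebesgue_measure R).-integrable `[a, b] (EFin \o L) ->
  absolutely_continuous a b w -> w a = 0 ->
  {ae @lebesgue_measure R, forall t, t \in `[a, b]%R ->
    exists2 D, is_derive t 1 w D & `|D| <= L t * `|w t|} ->
  w b = 0.
Proof.
move=> ab L0 intL acw wa aew.
pose Lam x := \int[@lebesgue_measure R]_(t in `[a, x]) L t.
pose F x := w x * w x * expR (- 2 * Lam x).
have Lam0 x : 0 <= Lam x by exact: Rintegral_ge0.
have acG : absolutely_continuous a b (fun x => expR (- 2 * Lam x)).
  (* Taking [Lam] as both dominating functions supplies the factor 2 of the exponent. *)
  apply: (ac_dominated ler01 (ac_Rintegral intL) (ac_Rintegral intL)).
  move=> x y _ _ _; rewrite -/(Lam x) -/(Lam y) mul1r.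
  apply: le_trans (expR_le0_lipschitz _ _) _.
  - by rewrite mulNr oppr_le0 mulr_ge0.
  - by rewrite mulNr oppr_le0 mulr_ge0.
  - by rewrite -mulrBr normrM normrN normr_nat mulr_natl mulr2n.
have Fab : F b <= F a.
  apply: (ac_derive_le0 ab); first exact: (acM ab (acM ab acw acw) acG).
  apply: filterS2 aew (ae_is_derive_Rintegral intL).
    exact: (ae_filter_ringOfSetsType (@lebesgue_measure R)).
  move=> t aewt dLam tab; have [D wD DL] := aewt tab; have {}dLam := dLam tab.
  have dF := is_deriveM (is_deriveM wD wD)
    (is_derive1_comp (is_derive_expR _) (is_deriveZ (- 2) dLam)).
  eexists; first exact: dF.
  rewrite /= /GRing.scale/= -/(Lam t).
  have -> : (w * w) t = w t * w t by [].
  have Gt := expR_gt0 (- 2 * Lam t).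
  have : w t * D <= L t * (w t * w t).
    apply: le_trans (ler_norm _) _; rewrite normrM.
    have -> : w t * w t = `|w t| * `|w t| by rewrite -normrM ger0_norm// -expr2 sqr_ge0.
    by rewrite mulrC mulrA; apply: ler_wpM2r.
  (* The product rule gives this derivative of [F], whose last factor is nonpositive by [wD_le]. *)
  move=> wD_le; rewrite (_ : _ + _ =
    2 * expR (- 2 * Lam t) * (w t * D - L t * (w t * w t))); last by ring.
  by rewrite pmulr_rle0 ?subr_le0// mulr_gt0.
move: Fab; rewrite /F wa !mul0r pmulr_lle0 ?expR_gt0// -expr2 => wb.
by apply/eqP; rewrite -sqrf_eq0 eq_le wb sqr_ge0.
Qed.

(** Dividing the difference of powers by [x - y] leaves [n.+1] monomials of degree [n], each bounded
    by [M ^+ n]. *)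
Lemma subrX_norm_le (R : realType) (M x y : R) (n : nat) :
  `|x| <= M -> `|y| <= M ->
  `|x ^+ n.+1 - y ^+ n.+1| <= n.+1%:R * M ^+ n * `|x - y|.
Proof.
move=> xM yM; rewrite subrXX normrM mulrC ler_wpM2r//.
apply: le_trans (ler_norm_sum _ _ _) _.
rewrite -[n.+1 in leRHS]card_ord mulr_natl -sumr_const; apply: ler_sum => i _.
rewrite normrM !normrX/=.
have -> : M ^+ n = M ^+ (n - i) * M ^+ i by rewrite -exprD subnK// -ltnS.
by apply: ler_pM => //; rewrite ?exprn_ge0// lerXn2r// nnegrE (le_trans _ xM).
Qed.

Lemma abel_solution_unique (R : realType) (m : nat) (omega : R)
    (v : nat -> R -> R) (r : R) (z1 z2 : R -> R) : 0 < omega ->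
  (forall i, (1 <= i)%N -> (i <= m)%N -> L1 omega (v i)) ->
  abel_solution m omega v r z1 -> abel_solution m omega v r z2 ->
  z1 omega = z2 omega.
Proof.
move=> omega0 hv [ac1 d1 i1] [ac2 d2 i2].
have [M1 M10 zM1] := ac_bounded (ltW omega0) ac1.
have [M2 M20 zM2] := ac_bounded (ltW omega0) ac2.
pose M := Num.max M1 M2; have M0 : 0 <= M by rewrite le_max M10.
(* Both solutions are bounded by [M], so [i.+1%:R * M ^+ i] is a Lipschitz constant for the power
   [i.+1] on their range. *)
pose L t := \sum_(1 <= i < m.+1) i.+1%:R * M ^+ i * `|v i t|.
apply/eqP; rewrite -subr_eq0; apply/eqP.
apply: (@ac_gronwall_eq0 _ 0 omega (fun t => z1 t - z2 t) L).
- exact: ltW.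
- by move=> t; apply: sumr_ge0 => i _; rewrite !mulr_ge0// exprn_ge0.
(* Repeating the range as a predicate keeps the bounds on [i] available, as integrability of [v i]
   needs them. *)
- have -> : EFin \o L = fun t => (\sum_(1 <= i < m.+1 | (1 <= i < m.+1)%N && true)
      (i.+1%:R * M ^+ i)%:E * `|(v i t)%:E|)%E.
    by apply/funext => t; rewrite /L/= -big_nat_cond -sumEFin.
  apply: integrable_sum => // i /andP[/andP[i1' im] _].
  by apply: integrableZl => //; apply: integrable_abse; exact: hv.
- exact: acB.
- by rewrite i1 i2 subrr.
- rewrite /ae_on in d1 d2; apply: filterS2 d1 d2.
    exact: (ae_filter_ringOfSetsType (@lebesgue_measure R)).
  move=> t d1t d2t tab; have {}d1t := d1t tab; have {}d2t := d2t tab.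
  eexists; first exact: is_deriveB d1t d2t.
  move: tab; rewrite in_itv/= => tab.
  rewrite -sumrB /L mulr_suml; apply: le_trans (ler_norm_sum _ _ _) _.
  apply: ler_sum => i _; rewrite -mulrBr normrM mulrC mulrAC ler_wpM2r//.
  by apply: subrX_norm_le; rewrite le_max ?zM1 ?zM2 ?orbT.
Qed.

(** * The explicit solution and the center *)

(** The terms below [m] sum to [u 1 * z ^+ 2 - u m * z ^+ m.+1], and the term of index [m] cancels
    the remainder. *)
Lemma abel_sum_telescope (R : comRingType) (m : nat) (v u : nat -> R) (z : R) :
  (1 <= m)%N ->
  (forall i, (1 <= i)%N -> (i < m)%N -> v i = u i - z * u i.+1) ->
  v m = u m ->
  \sum_(1 <= i < m.+1) v i * z ^+ i.+1 = u 1%N * z ^+ 2.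
Proof.
case: m => // m _ vi vm; rewrite big_nat_recr//= vm.
have vi' i : (1 <= i < m.+1)%N ->
    v i * z ^+ i.+1 = - (u i.+1 * z ^+ i.+2 - u i * z ^+ i.+1).
  by move=> /andP[i1 im]; rewrite vi// [z ^+ i.+2]exprS; ring.
by rewrite (eq_big_nat _ _ vi') sumrN telescope_sumr//; ring.
Qed.

Lemma abel_solution_of_system (R : realType) (m : nat) (omega r : R)
    (v u : nat -> R -> R) : (1 <= m)%N -> 0 < omega -> 0 < r ->
  L1 omega (u 1%N) ->
  (forall i : nat, (1 <= i)%N -> (i < m)%N ->
     ae_on omega (fun t => v i t = u i t - r * u i.+1 t / (1 - r * E_x1 u t))) ->
  ae_on omega (fun t => v m t = u m t) ->
  (forall t : R, 0 <= t -> t <= omega -> E_x1 u t < 1 / r) ->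
  abel_solution m omega v r (fun t => r / (1 - r * E_x1 u t)).
Proof.
move=> m1 omega0 r0 intu vi vm Er.
have acE : absolutely_continuous 0 omega (E_x1 u) by exact: ac_Rintegral.
have q0 t : 0 <= t <= omega -> 0 < 1 - r * E_x1 u t.
  by move=> /andP[t0 tw]; rewrite subr_gt0 mulrC -ltr_pdivlMr// Er.
(* At a maximum point of [E_x1 u] the denominator takes its least value [c > 0], which makes the
   quotient Lipschitz in [E_x1 u] with constant [r ^+ 2 / c ^+ 2]. *)
have [t0] := EVT_max (ltW omega0) (ac_continuous acE).
rewrite in_itv/= => t0w Et0; set c := 1 - r * E_x1 u t0.
have c0 : 0 < c by exact: q0.
have qc t : 0 <= t <= omega -> c <= 1 - r * E_x1 u t.
  by move=> tw; rewrite lerD2l lerN2 ler_pM2l// Et0// in_itv.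
split.
- apply: (@ac_dominated _ _ _ (r ^+ 2 / c ^+ 2) _ _ _ _ acE acE).
    by rewrite divr_ge0// exprn_ge0// ltW.
  move=> x y x0 xy yw.
  have xw : 0 <= x <= omega by rewrite x0 (le_trans xy).
  have {}yw : 0 <= y <= omega by rewrite yw (le_trans x0).
  have qx := q0 _ xw; have qy := q0 _ yw.
  have -> : r / (1 - r * E_x1 u y) - r / (1 - r * E_x1 u x) =
      r ^+ 2 / ((1 - r * E_x1 u y) * (1 - r * E_x1 u x)) * (E_x1 u y - E_x1 u x).
    by field; rewrite !gt_eqF.
  rewrite normrM ger0_norm; last by rewrite divr_ge0 ?sqr_ge0// mulr_ge0// ltW.
  apply: ler_pM => //; last by rewrite lerDl.
    by rewrite divr_ge0 ?sqr_ge0// mulr_ge0// ltW.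
  rewrite ler_wpM2l ?sqr_ge0// lef_pV2 ?posrE ?mulr_gt0 ?exprn_gt0//.
  by rewrite expr2; apply: ler_pM; rewrite ?(ltW c0)// qc.
(* One null set serves all equations: the statement is vacuous for other indices, and a countable
   union of null sets is null. *)
- have aevi : {ae @lebesgue_measure R, forall t, forall i, (1 <= i)%N -> (i < m)%N ->
      t \in `[0, omega]%R -> v i t = u i t - r * u i.+1 t / (1 - r * E_x1 u t)}.
    rewrite /ae_on in vi; apply: ae_foralln => i.
    have [/andP[i1 im]|nim] := boolP ((1 <= i < m)%N).
      apply: filterS (vi i i1 im); last by move=> t + _ _.
      exact: (ae_filter_ringOfSetsType (@lebesgue_measure R)).
    by apply: aeW => t i1 im; rewrite i1 im in nim.
  rewrite /ae_on in vm *; apply: filterS3 aevi vm (ae_is_derive_Rintegral intu).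
    exact: (ae_filter_ringOfSetsType (@lebesgue_measure R)).
  move=> t vit vmt dEt tw; have {}dEt := dEt tw.
  have qt : 0 < 1 - r * E_x1 u t by apply: q0; rewrite in_itv in tw.
  rewrite (@abel_sum_telescope _ _ _ (u^~ t))//; last exact: vmt; last first.
    by move=> i i1 im; rewrite vit// [r * _]mulrC -mulrA [u _ _ * _]mulrC.
  have dq : is_derive t 1 (fun x => 1 - r * E_x1 u x) (- (r * u 1%N t)).
    apply: is_derive_eq (is_deriveB (is_derive_cst (1 : R) t 1) (is_deriveZ r dEt)) _.
    by rewrite sub0r.
  (* The derivative simplifies to [r ^+ 2 * u 1 t / (1 - r * E_x1 u t) ^+ 2], that is [u_1 z^2]. *)
  have dz : is_derive t 1 (fun x => r / (1 - r * E_x1 u x)) _ :=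
    is_deriveZ r (@is_deriveV _ (fun x => 1 - r * E_x1 u x) _ _ _ (lt0r_neq0 qt) dq).
  apply: is_derive_eq dz _.
  by rewrite /GRing.scale/=; field; rewrite gt_eqF.
- have -> : E_x1 u 0 = 0 by rewrite /E_x1 set_itv1 Rintegral_set1.
  by rewrite mulr0 subr0 divr1.
Qed.

Theorem theorem8 (R : realType) (m : nat) (hm : (2 <= m)%N)
    (omega : R) (homega : 0 < omega) (v : nat -> R -> R)
    (hv : forall i : nat, (1 <= i)%N -> (i <= m)%N -> L1 omega (v i))
    (hsys : exists2 R0 : R, 0 < R0 &
      forall r : R, 0 < r -> r < R0 ->
      exists u : nat -> R -> R,
        (forall i : nat, (1 <= i)%N -> (i <= m)%N -> L1 omega (u i)) /\
        (forall i : nat, (1 <= i)%N -> (i < m)%N ->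
           ae_on omega (fun t =>
             v i t = u i t - r * u i.+1 t / (1 - r * E_x1 u t))) /\
        ae_on omega (fun t => v m t = u m t) /\
        (forall t : R, 0 <= t -> t <= omega -> E_x1 u t < 1 / r) /\
        E_x1 u omega = 0) :
  abel_center m omega v.
Proof.
have [R0 R00 sys] := hsys; exists R0 => // r r0 rR0.
have [u [hu [vi [vm [Er Ew]]]]] := sys r r0 rR0.
have sol := abel_solution_of_system (ltnW hm) homega r0
  (hu 1%N isT (ltnW hm)) vi vm Er.
split; first by eexists; exact: sol.
(* Uniqueness replaces [z omega] by the value of the explicit solution, which is [r] since
   [E_x1 u omega = 0]. *)
move=> z /(abel_solution_unique homega hv)/(_ sol)->.
by rewrite Ew mulr0 subr0 divr1.
Qed.
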